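(* Let $n\ge1$ and $r,s\in\mathbb{Z}$. If $D_n^{(r)}\ne0$, then for all $z\in\mathbb{C}$ $$P_n(z;r)=\frac{1}{D_n^{(r)}}\mathcal{D}_n\big[w(\zeta)\zeta^{-r}(z-\zeta)\big],\qquad Q_n(z;r)=\frac{1}{D_n^{(r)}}\mathcal{D}_n\big[w(\zeta)\zeta^{-r}(z-\zeta^{-2})\big].$$ If $E_n^{(s)}\ne0$, then for all $z\in\mathbb{C}$ $$R_n(z;s)=\frac{1}{E_n^{(s)}}\mathcal{E}_n\big[w(\zeta)\zeta^{-s}(z-\zeta^2)\big],\qquad S_n(z;s)=\frac{1}{E_n^{(s)}}\mathcal{E}_n\big[w(\zeta)\zeta^{-s}(z-\zeta^{-1})\big].$$
   Context: $\mathbb{T}$ is the unit circle, oriented counterclockwise; $w$ is a complex-valued integrable weight on $\mathbb{T}$ with Fourier coefficients $w_k=\int_{\mathbb{T}}\zeta^{-k}w(\zeta)\frac{d\zeta}{2\pi i\zeta}$. $D_n^{(r)}=\det(w_{r+2j-k})_{0\le j,k\le n-1}$, $E_n^{(s)}=\det(w_{s+j-2k})_{0\le j,k\le n-1}$ ($j$ row index, $k$ column index). For an integrable function $f$ on $\mathbb{T}$, $$\mathcal{D}_n[f(\zeta)]=\frac1{n!}\int_{\mathbb{T}}\frac{d\zeta_1}{2\pi i\zeta_1}\cdots\int_{\mathbb{T}}\frac{d\zeta_n}{2\pi i\zeta_n}\prod_{j=1}^nf(\zeta_j)\prod_{1\le j<k\le n}(\zeta_k-\zeta_j)(\zeta_k^{-2}-\zeta_j^{-2}),$$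 $$\mathcal{E}_n[f(\zeta)]=\frac1{n!}\int_{\mathbb{T}}\frac{d\zeta_1}{2\pi i\zeta_1}\cdots\int_{\mathbb{T}}\frac{d\zeta_n}{2\pi i\zeta_n}\prod_{j=1}^nf(\zeta_j)\prod_{1\le j<k\le n}(\zeta_k^2-\zeta_j^2)(\zeta_k^{-1}-\zeta_j^{-1}).$$ When $D_n^{(r)}\ne0$, $P_n(z;r)$ and $Q_n(z;r)$ are the unique monic polynomials of degree $n$ with $\int_{\mathbb{T}}P_n(\zeta;r)\zeta^{-2m-r}w(\zeta)\frac{d\zeta}{2\pi i\zeta}=0$ and $\int_{\mathbb{T}}Q_n(\zeta^{-2};r)\zeta^{m-r}w(\zeta)\frac{d\zeta}{2\pi i\zeta}=0$ for $0\le m\le n-1$. When $E_n^{(s)}\ne0$, $R_n(z;s)$ and $S_n(z;s)$ are the unique monic polynomials of degree $n$ with $\int_{\mathbb{T}}R_n(\zeta^2;s)\zeta^{-m-s}w(\zeta)\frac{d\zeta}{2\pi i\zeta}=0$ and $\int_{\mathbb{T}}S_n(\zeta^{-1};s)\zeta^{2m-s}w(\zeta)\frac{d\zeta}{2\pi i\zeta}=0$ for $0\le m\le n-1$. *)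

(* Defs.v *)
From HB Require Import structures.
From mathcomp Require Import all_boot all_order all_algebra.
From mathcomp Require Import all_classical all_reals all_analysis.
From mathcomp Require Export complex.

Set Implicit Arguments.
Unset Strict Implicit.
Unset Printing Implicit Defensive.

Import Order.TTheory GRing.Theory Num.Theory.
Import numFieldNormedType.Exports.

Local Open Scope classical_set_scope.
Local Open Scope complex_scope.
Local Open Scope ring_scope.

(* Functions on the unit circle T are represented by functions R[i] -> R[i];
   only their values on T are ever used. *)

Section circle_integral.
Variable R : realType.
Local Notation C := R[i].
Local Notation mu := (@lebesgue_measure R).

Definition expi (t : R) : C := cos t +i* sin t.

Definition circle_integrable (f : C -> C) : Prop :=
  mu.-integrable `[0, 2 * pi] (fun t => (complex.Re (f (expi t)))%:E) /\
  mu.-integrable `[0, 2 * pi] (fun t => (complex.Im (f (expi t)))%:E).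

(* \int_0^{2 pi} h(t) dt for complex-valued h *)
Definition cint (h : R -> C) : C :=
  (\int[mu]_(t in `[0, 2 * pi]) complex.Re (h t))
  +i* (\int[mu]_(t in `[0, 2 * pi]) complex.Im (h t)).

(* \int_T g(z) dz, with z = e^{it} and dz = i e^{it} dt *)
Definition contour_int (g : C -> C) : C :=
  cint (fun t => g (expi t) * ('i%C * expi t)).

(* \int_T f(z) dz / (2 pi i z) *)
Definition circle_int (f : C -> C) : C :=
  contour_int (fun z => f z / ((2 * pi)%:C * 'i%C * z)).

(* iterated integral of F z_1 ... z_n against the dz_j / (2 pi i z_j),
   the integral over z_1 being the outermost *)
Fixpoint iter_circle_int (n : nat) : (n.-tuple C -> C) -> C :=
  match n with
  | 0 => fun F => F [tuple]
  | m.+1 => fun F =>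
      circle_int (fun z => iter_circle_int (fun v : m.-tuple C => F [tuple of z :: v]))
  end.

End circle_integral.

Section toeplitz.
Variable R : realType.
Local Notation C := R[i].

Definition fourier (w : C -> C) (k : int) : C :=
  circle_int (fun z => z ^ (- k) * w z).

Definition Ddet (w : C -> C) (n : nat) (r : int) : C :=
  \det (\matrix_(j < n, k < n) fourier w (r + (2 * j)%N%:Z - k%:Z)).

Definition Edet (w : C -> C) (n : nat) (s : int) : C :=
  \det (\matrix_(j < n, k < n) fourier w (s + j%:Z - (2 * k)%N%:Z)).

Definition calD (n : nat) (f : C -> C) : C :=
  (n`!%:R)^-1 * iter_circle_int (fun v : n.-tuple C =>
    (\prod_(j < n) f (tnth v j)) *
    \prod_(j < n) \prod_(k < n | (j < k)%N)
      ((tnth v k - tnth v j) * (tnth v k ^- 2 - tnth v j ^- 2))).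

Definition calE (n : nat) (f : C -> C) : C :=
  (n`!%:R)^-1 * iter_circle_int (fun v : n.-tuple C =>
    (\prod_(j < n) f (tnth v j)) *
    \prod_(j < n) \prod_(k < n | (j < k)%N)
      ((tnth v k ^+ 2 - tnth v j ^+ 2) * ((tnth v k)^-1 - (tnth v j)^-1))).

(* The unique monic polynomial of degree n satisfying A; the zero polynomial
   when existence or uniqueness fails. *)
Definition the_monic (n : nat) (A : {poly C} -> Prop) : {poly C} :=
  xget 0 [set p | unique (fun q : {poly C} =>
                    [/\ q \is monic, size q = n.+1 & A q]) p].

Definition orthopoly_P (w : C -> C) (n : nat) (r : int) : {poly C} :=
  the_monic n (fun p => forall m : nat, (m < n)%N ->
    circle_int (fun z => p.[z] * z ^ (- (2 * m)%N%:Z - r) * w z) = 0).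

Definition orthopoly_Q (w : C -> C) (n : nat) (r : int) : {poly C} :=
  the_monic n (fun p => forall m : nat, (m < n)%N ->
    circle_int (fun z => p.[z ^- 2] * z ^ (m%:Z - r) * w z) = 0).

Definition orthopoly_R (w : C -> C) (n : nat) (s : int) : {poly C} :=
  the_monic n (fun p => forall m : nat, (m < n)%N ->
    circle_int (fun z => p.[z ^+ 2] * z ^ (- m%:Z - s) * w z) = 0).

Definition orthopoly_S (w : C -> C) (n : nat) (s : int) : {poly C} :=
  the_monic n (fun p => forall m : nat, (m < n)%N ->
    circle_int (fun z => p.[z^-1] * z ^ ((2 * m)%N%:Z - s) * w z) = 0).

End toeplitz.

(* Main.v *)
(* Put M_jk = \int g b^j a^k over the circle, where {a, b} = {zeta, zeta^-2} or
   {zeta^2, zeta^-1} and g is w times a power of zeta. The factors of the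
   multiple integral are two Vandermonde determinants, so Andreief's identity
   turns the n-fold integral with weight g (x - a) into n! det (x M_jk - M_j,k+1).
   For the monic orthogonal polynomial p, the orthogonality relations say that
   the column-shifted matrix (M_j,k+1) is M times the transposed companion matrix
   of p, so this determinant is det M times the characteristic polynomial of that
   companion matrix at x, i.e. det M * p(x). *)
Require Import Defs.
From mathcomp Require Import all_boot all_order all_fingroup all_algebra.
From mathcomp Require Import all_classical all_reals all_analysis measurable_realfun.
From mathcomp Require Import ring zify.
Import Order.TTheory GRing.Theory Num.Theory.
Import numFieldNormedType.Exports.
Set Implicit Arguments.
Unset Strict Implicit.
Unset Printing Implicit Defensive.
Local Open Scope ring_scope.

(** * Linear algebra: monic solutions of moment relations, and sums over pairs of permutations *)

Lemma horner_char_poly (K : comNzRingType) (n : nat) (A : 'M[K]_n) (x : K) :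
  (char_poly A).[x] = \det (x%:M - A).
Proof.
rewrite -[LHS]/(horner_eval x (char_poly A)) -det_map_mx.
congr (\det _); apply/matrixP=> i j.
rewrite !mxE -[LHS]/(_.[x]).
by rewrite hornerD hornerN hornerMn hornerX hornerC.
Qed.

Lemma horner_orthogonal_det (K : comNzRingType) (M : nat -> nat -> K) (n : nat)
    (p : {poly K}) (x : K) :
  p \is monic -> size p = n.+1 ->
  (forall m, (m < n)%N -> \sum_(k < n.+1) p`_k * M m k = 0) ->
  \det (\matrix_(j < n, k < n) (x * M j k - M j k.+1)) =
  p.[x] * \det (\matrix_(j < n, k < n) M j k).
Proof.
move=> p_monic size_p orth_p.
have dE : n = (size p).-1 by rewrite size_p.
have plead : p`_n = 1 by rewrite dE; apply/eqP: p_monic.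
(* [companionmx p] has dimension [(size p).-1], so [n] is replaced by that expression. *)
subst n; set d := (size p).-1 in orth_p plead *.
rewrite -[in RHS](companionmxK p_monic) horner_char_poly -[X in _ * X]det_tr.
rewrite -det_mulmx -[LHS]det_tr; congr (\det _); apply/matrixP=> k j.
rewrite mulmxBl mul_scalar_mx !mxE; congr (_ - _).
under eq_bigr do rewrite !mxE.
(* Row k of the companion matrix is the unit vector at k+1, which selects M_j,k+1, except the last
   row. That one holds the negated lower coefficients of p, and orthogonality turns its product into
   M_j,d. *)
have [kd|kd] := eqVneq (k : nat) d.-1.
  have kS : k.+1 = d by rewrite kd prednK // (leq_ltn_trans _ (ltn_ord k)).
  have /eqP := orth_p j (ltn_ord j).
  rewrite big_ord_recr /= plead mul1r addrC addr_eq0 => /eqP Mjd.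
  by rewrite kS Mjd -sumrN; apply: eq_bigr => i _; rewrite mulNr.
have kS : (k.+1 < d)%N.
  rewrite ltn_neqAle ltn_ord andbT; apply: contra kd => /eqP kSd.
  by rewrite -[k : nat]/(k.+1.-1) kSd.
rewrite (bigD1 (Ordinal kS)) //= eqxx mul1r big1 ?addr0 // => i.
by rewrite -val_eqE /= eq_sym => /negbTE ->; rewrite mul0r.
Qed.

(** With the leading coefficient fixed to 1, the n relations form a square linear system in the n
    lower coefficients, whose matrix is invertible. *)
Lemma unique_orthogonal_monic (K : fieldType) (M : nat -> nat -> K) (n : nat) :
  \det (\matrix_(j < n, k < n) M j k) != 0 ->
  exists p : {poly K}, unique (fun q : {poly K} =>
    [/\ q \is monic, size q = n.+1 &
        forall m, (m < n)%N -> \sum_(k < n.+1) q`_k * M m k = 0]) p.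
Proof.
set A := \matrix_(j, k) _ => detA_neq0.
have A_unit : A^T \in unitmx by rewrite unitmx_tr unitmxE unitfE.
have [u uA] : exists u : 'rV_n, u *m A^T = \row_(j < n) - M j n.
  by exists ((\row_(j < n) - M j n) *m invmx A^T); rewrite mulmxKV.
have size_u : (size (rVpoly u) < size ('X^n : {poly K}))%N.
  by rewrite size_polyXn ltnS size_poly.
exists ('X^n + rVpoly u); split.
  split; first by rewrite monicE lead_coefDl // lead_coefXn.
    by rewrite size_polyDl // size_polyXn.
  move=> m mn; rewrite big_ord_recr /= coefD coefXn eqxx coef_rVpoly.
  (* [rVpoly u] has coefficient 0 at n, since n is not an index in ['I_n]. *)
  case: insubP => [i|_]; first by rewrite ltnn.
  rewrite addr0 mul1r; have /rowP/(_ (Ordinal mn)) := uA.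
  rewrite !mxE => uAm; apply/eqP; rewrite addr_eq0 -uAm; apply/eqP.
  apply: eq_bigr => k _; rewrite !mxE coefD coefXn /= ltn_eqF // add0r.
  by rewrite coef_rVpoly_ord.
move=> q [q_monic size_q orth_q].
have qlead : q`_n = 1 by move/eqP: q_monic; rewrite lead_coefE size_q.
(* The lower coefficients of any other solution satisfy the same system, so cancelling [A^T]
   identifies them with [u]. *)
have qA : poly_rV (take_poly n q) *m A^T = \row_(j < n) - M j n.
  apply/rowP => j; have /eqP := orth_q j (ltn_ord j).
  rewrite big_ord_recr /= qlead mul1r addr_eq0 !mxE => /eqP <-.
  by apply: eq_bigr => k _; rewrite !mxE coef_take_poly ltn_ord.
have -> : u = poly_rV (take_poly n q).
  by rewrite -[LHS](mulmxK A_unit) uA -qA mulmxK.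
rewrite poly_rV_K ?size_take_poly //; apply/polyP => i.
rewrite coefD coefXn coef_take_poly; case: ltngtP => [||->]; rewrite ?add0r //.
  by move=> ni; rewrite nth_default // size_q.
by rewrite qlead addr0.
Qed.

(** For a fixed first permutation s, the sum over the second is (-1)^s times the determinant of [m]
    with its rows permuted by s, hence [\det m]. There are n! choices of s. *)
Lemma sum_prod_det_det (K : comNzRingType) (n : nat) (m : 'M[K]_n) :
  \sum_(st : 'S_n * 'S_n)
    (-1) ^+ st.1 * (-1) ^+ st.2 * \prod_i m (st.1 i) (st.2 i) = n`!%:R * \det m.
Proof.
rewrite -(pair_bigA _ (fun s t : 'S_n =>
   (-1) ^+ s * (-1) ^+ t * \prod_i m (s i) (t i))) /=.
rewrite (eq_bigr (fun=> \det m)) ?sumr_const ?card_Sn ?mulr_natl // => s _.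
transitivity ((-1) ^+ s * \det (row_perm s m)).
  rewrite mulr_sumr; apply: eq_bigr => t _.
  by rewrite mulrA; congr (_ * _); apply: eq_bigr => i _; rewrite mxE.
by rewrite row_permE det_mulmx det_perm mulrA -signr_addb addbb mul1r.
Qed.

(** * Integration over the circle through real and imaginary parts *)

Lemma complex_ReM (R : rcfType) (x y : R[i]) :
  complex.Re (x * y) =
  complex.Re x * complex.Re y - complex.Im x * complex.Im y.
Proof. by case: x => [a b]; case: y => [c d]. Qed.

Lemma complex_ImM (R : rcfType) (x y : R[i]) :
  complex.Im (x * y) =
  complex.Re x * complex.Im y + complex.Im x * complex.Re y.
Proof. by case: x => [a b]; case: y => [c d]. Qed.

Lemma complex_ReD (R : rcfType) (x y : R[i]) :
  complex.Re (x + y) = complex.Re x + complex.Re y.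
Proof. by case: x => [a b]; case: y => [c d]. Qed.

Lemma complex_ImD (R : rcfType) (x y : R[i]) :
  complex.Im (x + y) = complex.Im x + complex.Im y.
Proof. by case: x => [a b]; case: y => [c d]. Qed.

Section circle.
Local Open Scope complex_scope.
Variable R : realType.
Local Notation C := R[i].
Local Notation mu := (@lebesgue_measure R).
Implicit Types f g : C -> C.

Lemma expi_neq0 (t : R) : expi t != 0.
Proof.
rewrite eq_complex /=; apply/negP => /andP[/eqP cos0 /eqP sin0].
have := cos2Dsin2 t; rewrite cos0 sin0 expr0n addr0 => /esym/eqP.
by rewrite oner_eq0.
Qed.

Lemma eq_circle_int f g :
  (forall t, f (expi t) = g (expi t)) -> circle_int f = circle_int g.
Proof.
by move=> fg; congr (cint _); apply/funext => t; rewrite fg.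
Qed.

Lemma eq_circle_integrable f g : (forall t, f (expi t) = g (expi t)) ->
  circle_integrable f -> circle_integrable g.
Proof.
move=> fg [fRe fIm]; split.
  by apply: eq_integrable fRe => // t _; rewrite fg.
by apply: eq_integrable fIm => // t _; rewrite fg.
Qed.

(** For z = e^{it} the factor i z of dz cancels against the denominator 2 pi i z and leaves dt / (2
    pi). Integrability lets this constant out of the two real integrals. *)
Lemma circle_intE f : circle_integrable f ->
  circle_int f = ((2 * pi)^-1)%:C *
    ((\int[mu]_(t in `[0, 2 * pi]%classic) complex.Re (f (expi t))) +i*
     (\int[mu]_(t in `[0, 2 * pi]%classic) complex.Im (f (expi t)))).
Proof.
move=> [fRe fIm].
have E t : f (expi t) / ((2 * pi)%:C * 'i%C * expi t) * ('i%C * expi t) =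
    ((2 * pi)^-1)%:C * f (expi t).
  rewrite -(mulrA (2 * pi)%:C) invfM [f _ * _]mulrA mulfVK.
    by rewrite fmorphV mulrC.
  by rewrite mulf_neq0 ?expi_neq0 // neq0Ci.
rewrite /circle_int /contour_int /cint.
under [in X in X +i* _]eq_Rintegral do rewrite E complex_ReM mul0r subr0.
under [in X in _ +i* X]eq_Rintegral do rewrite E complex_ImM mul0r addr0.
rewrite !RintegralZl //.
by apply/eqP; rewrite eq_complex complex_ReM complex_ImM /= !mul0r subr0 addr0 !eqxx.
Qed.

Lemma circle_integrableD f g : circle_integrable f -> circle_integrable g ->
  circle_integrable (fun z => f z + g z).
Proof.
move=> [fRe fIm] [gRe gIm]; split.
  apply: eq_integrable (integrableD _ fRe gRe) => // t _ /=.
  by rewrite -EFinD complex_ReD.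
apply: eq_integrable (integrableD _ fIm gIm) => // t _ /=.
by rewrite -EFinD complex_ImD.
Qed.

Lemma circle_intD f g : circle_integrable f -> circle_integrable g ->
  circle_int (fun z => f z + g z) = circle_int f + circle_int g.
Proof.
move=> fi gi; rewrite !circle_intE //; last exact: circle_integrableD.
rewrite -mulrDr; congr (_ * _).
case: fi gi => [fRe fIm] [gRe gIm].
under [in X in X +i* _ = _]eq_Rintegral do rewrite complex_ReD.
under [in X in _ +i* X = _]eq_Rintegral do rewrite complex_ImD.
by rewrite !RintegralD.
Qed.

(** A continuous [h] is measurable, and bounded on the compact segment; multiplying by such a
    function preserves integrability. *)
Lemma integrable_continuous_mul (h k : R -> R) : continuous h ->
  mu.-integrable `[0, 2 * pi]%classic (EFin \o k) ->
  mu.-integrable `[0, 2 * pi]%classic (fun t => (h t * k t)%:E).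
Proof.
move=> h_cont ki; apply: (@integrableMr _ _ _ mu _ _ h (EFin \o k)) => //.
  apply: measurable_funTS; exact: continuous_measurable_fun.
have : bounded_set (h @` `[0, 2 * pi])%classic.
  apply: compact_bounded; apply: continuous_compact; last exact: segment_compact.
  exact: continuous_subspaceT.
rewrite /bounded_set /bounded_near.
apply: filterS => M hM t tD; apply: hM; exists t => //.
Qed.

Lemma circle_integrableM (h f : C -> C) :
  continuous (fun t : R => complex.Re (h (expi t))) ->
  continuous (fun t : R => complex.Im (h (expi t))) ->
  circle_integrable f -> circle_integrable (fun z => h z * f z).
Proof.
move=> hRe hIm [fRe fIm]; split.
  apply: eq_integrable (integrableB _ (integrable_continuous_mul hRe fRe)
                                      (integrable_continuous_mul hIm fIm)) => //.
  by move=> t _ /=; rewrite -EFinB complex_ReM.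
apply: eq_integrable (integrableD _ (integrable_continuous_mul hRe fIm)
                                    (integrable_continuous_mul hIm fRe)) => //.
by move=> t _ /=; rewrite -EFinD complex_ImM.
Qed.

Lemma circle_integrableZ (c : C) f :
  circle_integrable f -> circle_integrable (fun z => c * f z).
Proof. by apply: (@circle_integrableM (fun=> c)) => ?; exact: cst_continuous. Qed.

Lemma circle_integrableXz f (k : int) :
  circle_integrable f -> circle_integrable (fun z => z ^ k * f z).
Proof.
have X (n : nat) g : circle_integrable g ->
    circle_integrable (fun z => z ^+ n * g z).
  elim: n g => [|n IHn] g gi.
    by apply: eq_circle_integrable gi => t; rewrite expr0 mul1r.
  have := @circle_integrableM id _ (@continuous_cos R) (@continuous_sin R)
    (IHn _ gi).
  by apply: eq_circle_integrable => t; rewrite exprS mulrA.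
have V (n : nat) g : circle_integrable g ->
    circle_integrable (fun z => z ^- n * g z).
  elim: n g => [|n IHn] g gi.
    by apply: eq_circle_integrable gi => t; rewrite expr0 invr1 mul1r.
  (* On the circle 1/z is the conjugate of z, whose real and imaginary parts cos t and - sin t are
     continuous. *)
  have := @circle_integrableM (fun z => z^*) _ _ _ (IHn _ gi).
  have -> : (fun t : R => complex.Im (expi t)^*) = (fun t => - sin t) by [].
  move=> /(_ (@continuous_cos R))/(_ (fun t => continuousN (@continuous_sin R t))).
  apply: eq_circle_integrable => t; rewrite exprS invfM mulrA; congr (_ * _ * _).
  apply: (mulIf (expi_neq0 t)); rewrite mulVf ?expi_neq0 //.
  apply/eqP; rewrite eq_complex /=.
  by rewrite mulNr opprK -!expr2 cos2Dsin2 mulNr [sin t * _]mulrC subrr !eqxx.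
by case: k => n fi; [exact: X | exact: V].
Qed.

Lemma circle_intZ (c : C) f :
  circle_integrable f -> circle_int (fun z => c * f z) = c * circle_int f.
Proof.
move=> fi; rewrite !circle_intE //; last exact: circle_integrableZ.
rewrite mulrCA; congr (_ * _); case: fi => fRe fIm.
have Zi (x : R) (k : R -> R) : mu.-integrable `[0, 2 * pi]%classic (EFin \o k) ->
   mu.-integrable `[0, 2 * pi]%classic (EFin \o (fun t => x * k t)).
  exact: integrableZl.
under [in X in X +i* _ = _]eq_Rintegral do rewrite complex_ReM.
under [in X in _ +i* X = _]eq_Rintegral do rewrite complex_ImM.
rewrite RintegralB ?RintegralD ?RintegralZl //; try exact: Zi.
by case: c.
Qed.

Lemma circle_integrable0 : circle_integrable (fun=> 0 : C).
Proof. by split; exact: integrable0. Qed.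

Lemma circle_int0 : circle_int (fun=> 0 : C) = 0.
Proof.
transitivity (circle_int (fun=> 0 * 0 : C)).
  by apply: eq_circle_int => t; rewrite mulr0.
by rewrite circle_intZ ?mul0r //; exact: circle_integrable0.
Qed.

Section sum.
Variables (I : Type) (F : I -> C -> C).

Lemma circle_integrable_sum (s : seq I) :
  (forall i, circle_integrable (F i)) ->
  circle_integrable (fun z => \sum_(i <- s) F i z).
Proof.
move=> Fi; elim: s => [|i s IHs].
  by apply: eq_circle_integrable circle_integrable0 => t; rewrite big_nil.
have := circle_integrableD (Fi i) IHs.
by apply: eq_circle_integrable => t; rewrite big_cons.
Qed.

Lemma circle_int_sum (s : seq I) :
  (forall i, circle_integrable (F i)) ->
  circle_int (fun z => \sum_(i <- s) F i z) = \sum_(i <- s) circle_int (F i).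
Proof.
move=> Fi; elim: s => [|i s IHs].
  rewrite big_nil -[RHS]circle_int0; apply: eq_circle_int => t.
  by rewrite big_nil.
rewrite big_cons -IHs -circle_intD //; last exact: circle_integrable_sum.
by apply: eq_circle_int => t; rewrite big_cons.
Qed.
End sum.

(** * Iterated integrals and Andreief's identity *)

Lemma eq_iter_circle_int (n : nat) (F G : n.-tuple C -> C) :
  F =1 G -> iter_circle_int F = iter_circle_int G.
Proof. by move=> /funext ->. Qed.

(** The variables separate in each summand, so linearity of one-variable integrals suffices and
    Fubini's theorem is avoided. In the induction on n, the factor in the outer variable is a
    constant for the inner integrals and joins the coefficient [c a]; hence the general [c]. *)
Lemma iter_circle_int_sum_prod (I : Type) (s : seq I) (n : nat) (c : I -> C)
    (g : I -> 'I_n -> C -> C) : (forall a i, circle_integrable (g a i)) ->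
  iter_circle_int (fun v : n.-tuple C =>
     \sum_(a <- s) c a * \prod_i g a i (tnth v i)) =
  \sum_(a <- s) c a * \prod_i circle_int (g a i).
Proof.
elim: n c g => [|n IHn] c g gi /=.
  by apply: eq_bigr => a _; rewrite !big_ord0.
transitivity (circle_int (fun z => \sum_(a <- s)
    (c a * \prod_(i < n) circle_int (g a (lift ord0 i))) * g a ord0 z)).
  apply: eq_circle_int => t.
  transitivity (iter_circle_int (fun v : n.-tuple C => \sum_(a <- s)
      (c a * g a ord0 (expi t)) * \prod_i g a (lift ord0 i) (tnth v i))).
    apply: eq_iter_circle_int => v; apply: eq_bigr => a _.
    rewrite big_ord_recl -mulrA; congr (_ * (_ * _)).
    by apply: eq_bigr => i _; rewrite !(tnth_nth 0).
  rewrite (IHn (fun a => c a * g a ord0 (expi t)) (fun a i => g a (lift ord0 i))) //.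
  by apply: eq_bigr => a _; rewrite mulrAC.
rewrite circle_int_sum => [|a]; last exact: circle_integrableZ.
apply: eq_bigr => a _.
by rewrite circle_intZ // big_ord_recl -mulrA; congr (_ * _); rewrite mulrC.
Qed.

(** Andreief's identity: the Leibniz expansions of both determinants make the integrand a sum of
    separated products over pairs of permutations. Termwise integration gives the sum of
    [sum_prod_det_det] for the matrix of integrals. *)
Lemma iter_circle_int_det_det (n : nat) (f : C -> C) (phi psi : 'I_n -> C -> C) :
  (forall j k, circle_integrable (fun z => f z * phi j z * psi k z)) ->
  iter_circle_int (fun v : n.-tuple C =>
    (\prod_i f (tnth v i)) * (\det (\matrix_(i, j) phi j (tnth v i)) *
                              \det (\matrix_(i, j) psi j (tnth v i)))) =
  n`!%:R * \det (\matrix_(j, k) circle_int (fun z => f z * phi j z * psi k z)).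
Proof.
move=> fi; rewrite -sum_prod_det_det.
under [RHS]eq_bigr do under eq_bigr do rewrite mxE.
(* The right side is turned back into an iterated integral, so that only a pointwise identity of
   integrands remains. *)
rewrite -(iter_circle_int_sum_prod (index_enum _)
  (fun st : 'S_n * 'S_n => (-1) ^+ st.1 * (-1) ^+ st.2)
  (fun st i => fi (st.1 i) (st.2 i))).
apply: eq_iter_circle_int => v.
rewrite -(pair_bigA _ (fun s t : 'S_n => (-1) ^+ s * (-1) ^+ t *
   \prod_i (f (tnth v i) * phi (s i) (tnth v i) * psi (t i) (tnth v i)))) /=.
rewrite mulr_suml mulr_sumr; apply: eq_bigr => s _.
rewrite !mulr_sumr; apply: eq_bigr => t _.
rewrite !big_split /=.
under [X in _ * (_ * X * _) = _]eq_bigr do rewrite mxE.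
under [X in _ * (_ * (_ * X)) = _]eq_bigr do rewrite mxE.
by rewrite [X in _ * X = _]mulrACA [LHS]mulrCA !mulrA.
Qed.

Lemma iter_circle_int_Vandermonde (n : nat) (f a b : C -> C) :
  (forall j k : nat, circle_integrable (fun z => f z * b z ^+ j * a z ^+ k)) ->
  iter_circle_int (fun v : n.-tuple C =>
    (\prod_(j < n) f (tnth v j)) *
    \prod_(j < n) \prod_(k < n | (j < k)%N)
      ((a (tnth v k) - a (tnth v j)) * (b (tnth v k) - b (tnth v j)))) =
  n`!%:R *
  \det (\matrix_(j < n, k < n) circle_int (fun z => f z * b z ^+ j * a z ^+ k)).
Proof.
move=> fi; have := @iter_circle_int_det_det n f (fun j z => b z ^+ j)
  (fun k z => a z ^+ k) (fun j k => fi j k) => <-.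
apply: eq_iter_circle_int => v; congr (_ * _).
have V (c : C -> C) : \det (\matrix_(i < n, j < n) c (tnth v i) ^+ j) =
    \prod_(j < n) \prod_(k < n | (j < k)%N) (c (tnth v k) - c (tnth v j)).
  transitivity (\det (Vandermonde n (\row_j c (tnth v j)))).
    (* The points index the columns of [Vandermonde] but the rows here, hence the transpose. *)
    by rewrite -det_tr; congr (\det _); apply/matrixP => i j; rewrite !mxE.
  rewrite det_Vandermonde; apply: eq_bigr => i _; apply: eq_bigr => j _.
  by rewrite !mxE.
rewrite !V mulrC -big_split; apply: eq_bigr => j _; exact: big_split.
Qed.

(** * Orthogonal polynomials as multiple integrals *)

Lemma horner_the_monic_det (n : nat) (g a b : C -> C) (x : C) :
  (forall j k : nat, circle_integrable (fun z => g z * b z ^+ j * a z ^+ k)) ->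
  let D := \det (\matrix_(j < n, k < n)
    circle_int (fun z => g z * b z ^+ j * a z ^+ k)) in
  D != 0 ->
  (the_monic n (fun p => forall m : nat, (m < n)%N ->
    circle_int (fun z => p.[a z] * b z ^+ m * g z) = 0)).[x] =
  D^-1 * (n`!%:R^-1 * iter_circle_int (fun v : n.-tuple C =>
    (\prod_(j < n) (g (tnth v j) * (x - a (tnth v j)))) *
    \prod_(j < n) \prod_(k < n | (j < k)%N)
      ((a (tnth v k) - a (tnth v j)) * (b (tnth v k) - b (tnth v j))))).
Proof.
move=> gi D D_neq0.
pose M j k := circle_int (fun z => g z * b z ^+ j * a z ^+ k).
(* Expanding p in powers of a, linearity pairs its coefficients with row m of [M]. The orthogonality
   integrals thus become the linear relations of [unique_orthogonal_monic]. *)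
have orthE (p : {poly C}) m : size p = n.+1 ->
    circle_int (fun z => p.[a z] * b z ^+ m * g z) = \sum_(k < n.+1) p`_k * M m k.
  move=> size_p.
  transitivity (circle_int (fun z =>
      \sum_(k < n.+1) p`_k * (g z * b z ^+ m * a z ^+ k))).
    apply: eq_circle_int => t; rewrite horner_coef size_p -mulrA mulr_suml.
    apply: eq_bigr => k _.
    by rewrite -mulrA; congr (_ * _); rewrite mulrC [b _ ^+ _ * _]mulrC.
  rewrite circle_int_sum => [|k]; last exact: circle_integrableZ.
  by apply: eq_bigr => k _; rewrite circle_intZ.
have [p [[p_monic size_p orth_p] p_unique]] :=
  @unique_orthogonal_monic _ M n D_neq0.
have -> : the_monic n (fun p => forall m : nat, (m < n)%N ->
    circle_int (fun z => p.[a z] * b z ^+ m * g z) = 0) = p.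
  have p_the : unique (fun q : {poly C} => [/\ q \is monic, size q = n.+1 &
      forall m : nat, (m < n)%N ->
        circle_int (fun z => q.[a z] * b z ^+ m * g z) = 0]) p.
    split=> [|q [q_monic size_q orth_q]].
      by split=> // m mn; rewrite orthE // orth_p.
    by apply: p_unique; split=> // m mn; rewrite -orthE // orth_q.
  (* [the_monic] chooses among the unique solutions: p is one, and every other candidate equals p,
     so the default 0 is not returned. *)
  apply: xget_unique => // q [[q_monic size_q orth_q] _].
  by case: p_the => _ /(_ q) ->.
(* Multiplying the weight by x - a replaces the moment M_jk by x M_jk - M_j,k+1. *)
have shift_int j k t :
    g (expi t) * (x - a (expi t)) * b (expi t) ^+ j * a (expi t) ^+ k =
    x * (g (expi t) * b (expi t) ^+ j * a (expi t) ^+ k) +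
    -1 * (g (expi t) * b (expi t) ^+ j * a (expi t) ^+ k.+1).
  by rewrite exprS; ring.
have fi j k : circle_integrable (fun z => g z * (x - a z) * b z ^+ j * a z ^+ k).
  apply: eq_circle_integrable (circle_integrableD (circle_integrableZ x (gi j k))
    (circle_integrableZ (-1) (gi j k.+1))) => t.
  by rewrite shift_int.
rewrite (iter_circle_int_Vandermonde n fi) mulKf ?pnatr_eq0 -?lt0n ?fact_gt0 //.
apply: (canRL (mulKf D_neq0)).
rewrite mulrC -(horner_orthogonal_det _ p_monic size_p orth_p).
congr (\det _); apply/matrixP => j k; rewrite !mxE; symmetry.
transitivity (circle_int (fun z => x * (g z * b z ^+ j * a z ^+ k) +
    -1 * (g z * b z ^+ j * a z ^+ k.+1))).
  by apply: eq_circle_int => t; exact: shift_int.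
rewrite circle_intD; try exact: circle_integrableZ.
by rewrite !circle_intZ // mulN1r.
Qed.

(** * Powers of zeta as a and b, with Fourier coefficients as moments *)

Section moments.
Variables (w : C -> C) (hw : circle_integrable w) (n : nat).
Variables (alpha beta r : int) (c : nat -> int) (D : C).
Hypothesis cE : forall m, c m = beta * m%:Z - r.

(** Taking a = z^alpha, b = z^beta and g = w z^(-r) makes each moment a Fourier coefficient of [w].
    The exponents [c] and the value [D] stay abstract so that each family can be matched with its
    own definition, up to an integer identity or a transposition. *)
Lemma horner_the_monic_moments (x : C) :
  \det (\matrix_(j < n, k < n)
    fourier w (r - beta * (j : nat)%:Z - alpha * (k : nat)%:Z)) = D ->
  D != 0 ->
  (the_monic n (fun p => forall m : nat, (m < n)%N ->
    circle_int (fun z => p.[z ^ alpha] * z ^ c m * w z) = 0)).[x] =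
  D^-1 * (n`!%:R^-1 * iter_circle_int (fun v : n.-tuple C =>
    (\prod_(j < n) (w (tnth v j) * tnth v j ^ (- r) * (x - tnth v j ^ alpha))) *
    \prod_(j < n) \prod_(k < n | (j < k)%N)
      ((tnth v k ^ alpha - tnth v j ^ alpha) *
       (tnth v k ^ beta - tnth v j ^ beta)))).
Proof.
pose g z := w z * z ^ (- r).
have gE j k t : g (expi t) * (expi t ^ beta) ^+ j * (expi t ^ alpha) ^+ k =
    expi t ^ (- (r - beta * j%:Z - alpha * k%:Z)) * w (expi t).
  rewrite !exprnP !exprz_exp /g -!mulrA -!expfzDr ?expi_neq0 // mulrC.
  by congr (_ ^ _ * _); ring.
have -> : \det (\matrix_(j < n, k < n)
    fourier w (r - beta * (j : nat)%:Z - alpha * (k : nat)%:Z)) =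
    \det (\matrix_(j < n, k < n)
      circle_int (fun z => g z * (z ^ beta) ^+ j * (z ^ alpha) ^+ k)).
  congr (\det _); apply/matrixP => j k; rewrite !mxE.
  by apply: eq_circle_int => t; rewrite gE.
move=> <- D_neq0.
have gi j k :
    circle_integrable (fun z => g z * (z ^ beta) ^+ j * (z ^ alpha) ^+ k).
  apply: eq_circle_integrable (circle_integrableXz _ hw) => t.
  by rewrite gE.
rewrite -(horner_the_monic_det x gi D_neq0).
congr (the_monic n _).[x]; apply/funext => p.
have cgE m : circle_int (fun z => p.[z ^ alpha] * z ^ c m * w z) =
    circle_int (fun z => p.[z ^ alpha] * (z ^ beta) ^+ m * g z).
  apply: eq_circle_int => t.
  rewrite cE exprnP exprz_exp /g expfzDr ?expi_neq0 // -!mulrA.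
  by congr (_ * (_ * _)); rewrite mulrC.
by apply/propext; split=> orth m mn; [rewrite -cgE | rewrite cgE]; exact: orth.
Qed.

(** This order of the two differences serves Q and S: there a is the negative power of zeta, whose
    differences come second in [calD] and [calE]. *)
Lemma horner_the_monic_momentsC (x : C) :
  \det (\matrix_(j < n, k < n)
    fourier w (r - beta * (j : nat)%:Z - alpha * (k : nat)%:Z)) = D ->
  D != 0 ->
  (the_monic n (fun p => forall m : nat, (m < n)%N ->
    circle_int (fun z => p.[z ^ alpha] * z ^ c m * w z) = 0)).[x] =
  D^-1 * (n`!%:R^-1 * iter_circle_int (fun v : n.-tuple C =>
    (\prod_(j < n) (w (tnth v j) * tnth v j ^ (- r) * (x - tnth v j ^ alpha))) *
    \prod_(j < n) \prod_(k < n | (j < k)%N)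
      ((tnth v k ^ beta - tnth v j ^ beta) *
       (tnth v k ^ alpha - tnth v j ^ alpha)))).
Proof.
move=> DE D_neq0; rewrite horner_the_monic_moments //; congr (_ * (_ * _)).
apply: eq_iter_circle_int => v; congr (_ * _).
by apply: eq_bigr => j _; apply: eq_bigr => k _; rewrite mulrC.
Qed.

End moments.

End circle.

(** * The four families, with exponents (alpha, beta) equal to (1, -2), (-2, 1), (2, -1) and (-1,
    2) *)

Theorem theorem5p3 (R : realType) (w : R[i] -> R[i]) (hw : circle_integrable w)
    (n : nat) (hn : (1 <= n)%N) (r s : int) :
  (Ddet w n r <> 0 ->
     forall z : R[i],
       (orthopoly_P w n r).[z] =
         (Ddet w n r)^-1 * calD n (fun x => w x * x ^ (- r) * (z - x)) /\
       (orthopoly_Q w n r).[z] =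
         (Ddet w n r)^-1 * calD n (fun x => w x * x ^ (- r) * (z - x ^- 2))) /\
  (Edet w n s <> 0 ->
     forall z : R[i],
       (orthopoly_R w n s).[z] =
         (Edet w n s)^-1 * calE n (fun x => w x * x ^ (- s) * (z - x ^+ 2)) /\
       (orthopoly_S w n s).[z] =
         (Edet w n s)^-1 * calE n (fun x => w x * x ^ (- s) * (z - x^-1))).
Proof.
(* Negz k is -(k+1), and x ^ Negz k is convertible to x ^- k.+1. *)
split=> /eqP det_neq0 z; split.
- apply: (@horner_the_monic_moments _ _ hw n (Posz 1) (Negz 1) r
      (fun m => - (2 * m)%N%:Z - r) _ _ z _ det_neq0) => [m|]; first by lia.
  by congr (\det _); apply/matrixP => j k; rewrite !mxE; congr fourier; lia.
- apply: (@horner_the_monic_momentsC _ _ hw n (Negz 1) (Posz 1) r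
      (fun m => m%:Z - r) _ _ z _ det_neq0) => [m|]; first by lia.
  (* Compared with P, the roles of a and b are exchanged, so the moment matrix is the transpose of
     the one in [Ddet]. The same happens for S and [Edet]. *)
  rewrite -[RHS]det_tr; congr (\det _); apply/matrixP => j k; rewrite !mxE.
  by congr fourier; lia.
- apply: (@horner_the_monic_moments _ _ hw n (Posz 2) (Negz 0) s
      (fun m => - m%:Z - s) _ _ z _ det_neq0) => [m|]; first by lia.
  by congr (\det _); apply/matrixP => j k; rewrite !mxE; congr fourier; lia.
- apply: (@horner_the_monic_momentsC _ _ hw n (Negz 0) (Posz 2) s
      (fun m => (2 * m)%N%:Z - s) _ _ z _ det_neq0) => [m|]; first by lia.
  rewrite -[RHS]det_tr; congr (\det _); apply/matrixP => j k; rewrite !mxE.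
  by congr fourier; lia.
Qed.
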